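(* Let $(X_t)_{t\in\mathbb Z}$ be a stationary Markov chain and let $k\ge 2$. Then the intrinsic incremental space $\mathcal I_k$ satisfies $$\mathcal I_k=\ker P_k\cap\ker P_k^*.$$ Consequently, the Green--Kubo series $I+\sum_{h\ge1}P_k^h+\sum_{h\ge1}(P_k^* )^h$ converges trivially on $\mathcal I_k$ (for every $f\in\mathcal I_k$ all terms $P_k^hf$ and $(P_k^* )^hf$ with $h\ge 1$ vanish), and $$B_kf=f,\qquad f\in\mathcal I_k.$$ Hence $1$ is an eigenvalue of $B_k$ whenever $\mathcal I_k\neq\{0\}$, and every (nonzero) element of $\mathcal I_k$ is an eigenfunction of $B_k$ associated with this eigenvalue.
   Context: $(X_t)_{t\in\mathbb Z}$ is a stationary Markov chain on a measurable space $(E,\mathcal E)$ with invariant distribution $\nu$ and transition kernel $K$. For $k\ge 2$, $\pi_k$ is the law of $(X_1,\ldots,X_k)$, i.e. $\pi_k(dx_1,\ldots,dx_k)=\nu(dx_1)K(x_1,dx_2)\cdots K(x_{k-1},dx_k)$, which is the invariant law of the $k$-window Markov chain $Y_t^{(k)}=(X_t,\ldots,X_{t+k-1})$. $\mathcal H_k=L^2_0(\pi_k)$ is the Hilbert space of real-valued $f\in L^2(\pi_k)$ with $\int f\,d\pi_k=0$; for $f\in\mathcal H_k$ one identifies $f$ with the random variable $f(X_1,\ldots,X_k)$. The transition operator of the $k$-window chain acts on $\mathcal H_k$ by $$(P_kf)(x_1,\ldots,x_k)=\int_E f(x_2,\ldots,x_k,z)\,K(x_k,dz),$$ and $P_k^*$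 is its Hilbert-space adjoint on $\mathcal H_k$ (the transition operator of the time-reversed window chain). The Green--Kubo covariance operator is $B_k=I+\sum_{h\ge1}P_k^h+\sum_{h\ge1}(P_k^* )^h$, defined on those $f\in\mathcal H_k$ for which the series converges. Intrinsic incremental space: let $W_{k-1}^L\subset\mathcal H_k$ be the subspace of centered square-integrable functions of the form $u(X_1,\ldots,X_{k-1})$ and $W_{k-1}^R\subset\mathcal H_k$ the subspace of centered square-integrable functions of the form $v(X_2,\ldots,X_k)$. Then $\mathcal I_k=(W_{k-1}^L+W_{k-1}^R)^\perp$, the orthogonal complement being taken in $\mathcal H_k$. *)

(* Defs.v *)
From HB Require Import structures.
From mathcomp Require Import all_boot all_order all_algebra.
From mathcomp Require Import all_classical all_reals all_analysis.

Set Implicit Arguments.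
Unset Strict Implicit.
Unset Printing Implicit Defensive.
Import Order.TTheory GRing.Theory Num.Theory.
Import numFieldNormedType.Exports.

Local Open Scope classical_set_scope.
Local Open Scope ring_scope.

(* The Hilbert space L^2_0(mu) is handled through representatives: its elements
   are square-integrable functions T -> R, and equality in L^2_0(mu) is
   [f = g %[ae mu]]. All the sets of functions below are closed under this
   equality, so that equality of sets is equality of subspaces. *)
Section L2_0.
Context d (T : measurableType d) (R : realType) (mu : probability T R).

Definition L2_0 : set (T -> R) :=
  [set f | f \in Lfun mu 2%:E /\ ('E_mu[f] = 0)%E].

Definition dotL2 (f g : T -> R) : R := \int[mu]_x (f x * g x).

Definition zero_space : set (T -> R) :=
  [set f | L2_0 f /\ f = cst 0 %[ae mu]].

Definition kernel_space (A : (T -> R) -> (T -> R)) : set (T -> R) :=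
  [set f | L2_0 f /\ A f = cst 0 %[ae mu]].

Definition sum_space (V W : set (T -> R)) : set (T -> R) :=
  [set f | exists2 v, V v & exists2 w, W w & f = v \+ w].

Definition orthogonal_space (W : set (T -> R)) : set (T -> R) :=
  [set f | L2_0 f /\ forall w, W w -> dotL2 f w = 0].

(* [adjoint A f] is a representative of the element g of L^2_0(mu) such that
   <h, g> = <A h, f> for all h. For a bounded operator A, such a g exists by the
   Riesz representation theorem, and is unique up to mu-a.e. equality; the
   default value [cst 0] plays no role then. *)
Definition adjoint (A : (T -> R) -> (T -> R)) (f : T -> R) : T -> R :=
  xget (cst 0)
    [set g | L2_0 g /\ forall h, L2_0 h -> dotL2 h g = dotL2 (A h) f].

(* s is the sum of the series u 1 + u 2 + ... for the norm of L^2(mu) *)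
Definition is_L2_sum (u : nat -> T -> R) (s : T -> R) : Prop :=
  L2_0 s /\
  ('N[mu]_2%:E[EFin \o ((\sum_(1 <= h < n.+1) u h)%R \- s)%R])%E
    @[n --> \oo] --> 0%E.

Definition L2_sum (u : nat -> T -> R) : T -> R :=
  xget (cst 0) (is_L2_sum u).

Definition green_kubo_domain (P : (T -> R) -> (T -> R)) : set (T -> R) :=
  [set f | [/\ L2_0 f,
    exists s, is_L2_sum (fun h => iter h P f) s &
    exists s, is_L2_sum (fun h => iter h (adjoint P) f) s]].

(* meaningful on [green_kubo_domain P] only *)
Definition green_kubo (P : (T -> R) -> (T -> R)) (f : T -> R) : T -> R :=
  f \+ L2_sum (fun h => iter h P f) \+ L2_sum (fun h => iter h (adjoint P) f).

(* eigenfunctions and eigenvalues of an operator B with domain D *)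
Definition eigenfunction (D : set (T -> R)) (B : (T -> R) -> (T -> R))
    (lambda : R) (f : T -> R) : Prop :=
  [/\ D f, ~ (f = cst 0 %[ae mu]) & B f = (fun x => lambda * f x) %[ae mu]].

Definition has_eigenvalue (D : set (T -> R)) (B : (T -> R) -> (T -> R))
    (lambda : R) : Prop :=
  exists f, eigenfunction D B lambda f.

End L2_0.

Section windows.
Context d dE (Omega : measurableType d) (E : measurableType dE) (R : realType).
Variables (Pr : probability Omega R) (X : int -> {RV Pr >-> E}).

Definition window_fun (t : int) (k : nat) (omega : Omega) : k.-tuple E :=
  [tuple X (t + i%:Z) omega | i < k].

Lemma measurable_window (t : int) (k : nat) :
  measurable_fun [set: Omega] (window_fun t k).
Proof.
apply/measurable_fun_tnthP => i.
rewrite (_ : _ \o _ = X (t + i%:Z)); last first.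
  by apply/funext => omega /=; rewrite tnth_mktuple.
exact: measurable_funPT.
Qed.

HB.instance Definition _ (t : int) (k : nat) :=
  isMeasurableFun.Build _ _ _ _ (window_fun t k) (@measurable_window t k).

(* the random variable (X_t, ..., X_{t+k-1}) *)
Definition window (t : int) (k : nat) : {RV Pr >-> (k.-tuple E)} :=
  window_fun t k.

(* pi_k, the law of (X_1, ..., X_k) *)
Definition window_law (k : nat) : probability (k.-tuple E) R :=
  distribution Pr (window 1 k).

(* the sigma-algebra generated by the X_s, s <= t *)
Definition past (t : int) : set (set Omega) :=
  <<s \bigcup_(s in [set s : int | s <= t])
        preimage_set_system [set: Omega] (X s) measurable >>.

(* Conditional on the past up to time t, X_{t+1} has law K(X_t, .). *)
Record stationary_markov_chain (nu : probability E R) (K : R.-pker E ~> E) :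
    Prop := StationaryMarkovChain {
  chain_invariant : forall A, measurable A -> (\int[nu]_x K x A)%E = nu A ;
  chain_marginal : forall t A, measurable A ->
    distribution Pr (X t) A = nu A ;
  chain_stationary : forall (s t : int) (n : nat) (A : set (n.-tuple E)),
    measurable A ->
    distribution Pr (window s n) A = distribution Pr (window t n) A ;
  chain_markov : forall (t : int) (B : set Omega) (A : set E),
    past t B -> measurable A ->
    Pr (B `&` X (t + 1) @^-1` A) = (\int[Pr]_(omega in B) K (X t omega) A)%E
}.

End windows.

Section transition.
Context dE (E : measurableType dE) (R : realType) (k : nat).

(* (x_1, ..., x_k), z |-> (x_2, ..., x_k, z): [nth z x k] is the default z *)
Definition shift (x : k.-tuple E) (z : E) : k.-tuple E :=
  [tuple nth z x i.+1 | i < k].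

(* For k >= 1, [nth point x k.-1] is x_k. *)
Definition transition (K : R.-pker E ~> E) (f : k.-tuple E -> R)
    (x : k.-tuple E) : R :=
  \int[K (nth point x k.-1)]_z f (shift x z).

Definition drop_last (x : k.-tuple E) : k.-1.-tuple E :=
  [tuple nth point x i | i < k.-1].

Definition drop_first (x : k.-tuple E) : k.-1.-tuple E :=
  [tuple nth point x i.+1 | i < k.-1].

Variable pik : probability (k.-tuple E) R.

Definition left_space : set (k.-tuple E -> R) :=
  [set f | L2_0 pik f /\ exists u : k.-1.-tuple E -> R,
     measurable_fun [set: k.-1.-tuple E] u /\ f = u \o drop_last %[ae pik]].

Definition right_space : set (k.-tuple E -> R) :=
  [set f | L2_0 pik f /\ exists v : k.-1.-tuple E -> R,
     measurable_fun [set: k.-1.-tuple E] v /\ f = v \o drop_first %[ae pik]].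

Definition incremental_space : set (k.-tuple E -> R) :=
  orthogonal_space pik (sum_space left_space right_space).

End transition.

(* Main.v *)
(* Write L x = (x_1, ..., x_{k-1}) and R x = (x_2, ..., x_k). Stationarity says
   that L and R have the same law under pi_k, and the Markov property that
   C f (s) = int f(s, z) K(s_{k-1}, dz) is a version of E[f | L = s]; moreover
   P f = (C f) o R. Hence f is orthogonal to the functions of L iff C f o L = 0
   iff P f = 0. Dually, <P h, f> = <(C h) o R, f>, and every function v o R is of
   this form, with h = v o L; so f is orthogonal to the functions of R iff
   P^* f = 0. The adjoint exists because P^* f = E[f | R = .] o L, the conditional
   expectation being a Radon-Nikodym derivative. On the intersection of the
   kernels, all terms of both Green-Kubo series vanish. *)
Require Import Defs.
From HB Require Import structures.
From mathcomp Require Import all_boot all_order all_algebra.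
From mathcomp Require Import all_classical all_reals all_analysis.
From mathcomp Require Import measurable_realfun.
From mathcomp Require Import zify.

Set Implicit Arguments.
Unset Strict Implicit.
Unset Printing Implicit Defensive.
Import Order.TTheory GRing.Theory Num.Theory.
Import numFieldNormedType.Exports.

Local Open Scope classical_set_scope.
Local Open Scope ring_scope.

(** * Square-integrable and centred functions up to a.e. equality *)

Section L2_0_theory.
Context d (T : measurableType d) (R : realType) (mu : probability T R).
Implicit Types f g h : T -> R.

Lemma Lfun2P f : f \in Lfun mu 2%:E <->
  measurable_fun setT f /\ (\int[mu]_x (f x ^+ 2)%:E < +oo)%E.
Proof.
split=> [f2|[mf f2]].
  split; first by move: f2; rewrite inE => /andP[]; rewrite inE.
  exact/integrable_lty/Lfun2_integrable_sqr.
rewrite inE; apply/andP; split; rewrite inE//= /finite_norm unlock poweR_lty//.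
under eq_integral => x _ do rewrite /= powR_mulrn// -normrX ger0_norm ?sqr_ge0//.
by [].
Qed.

Lemma Lfun2_measurable f : f \in Lfun mu 2%:E -> measurable_fun setT f.
Proof. by case/Lfun2P. Qed.

Lemma Lfun2_integrable f : f \in Lfun mu 2%:E -> mu.-integrable setT (EFin \o f).
Proof.
move=> f2; apply/Lfun1_integrable; apply: Lfun_subset12 => //.
exact: fin_num_measure.
Qed.

Lemma Lfun2M_integrable f g : f \in Lfun mu 2%:E -> g \in Lfun mu 2%:E ->
  mu.-integrable setT (EFin \o (fun x => f x * g x)).
Proof. by move=> f2 g2; apply/Lfun1_integrable; exact: Lfun2_mul_Lfun1. Qed.

Lemma Lfun2B f g : f \in Lfun mu 2%:E -> g \in Lfun mu 2%:E ->
  f \- g \in Lfun mu 2%:E.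
Proof. move=> f2 g2; refine (rpredB f2 g2); exact: lee1n. Qed.

Lemma Lfun2_norm f : f \in Lfun mu 2%:E -> (fun x => `|f x|) \in Lfun mu 2%:E.
Proof.
move=> /Lfun2P[mf f2]; apply/Lfun2P; split; first exact: measurableT_comp.
under eq_integral do rewrite real_normK ?num_real//.
by [].
Qed.

Lemma dotL2E f g : f \in Lfun mu 2%:E -> g \in Lfun mu 2%:E ->
  (\int[mu]_x (f x * g x)%:E = (dotL2 mu f g)%:E)%E.
Proof.
by move=> f2 g2; rewrite fineK//; exact/integrable_fin_num/Lfun2M_integrable.
Qed.

Lemma dotL2_ge0 f : 0 <= dotL2 mu f f.
Proof. by apply: Rintegral_ge0 => x _; rewrite -expr2 sqr_ge0. Qed.

Lemma dotL2C f g : dotL2 mu f g = dotL2 mu g f.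
Proof. by apply: eq_Rintegral => x _; rewrite mulrC. Qed.

Lemma dotL2Dr f g h : f \in Lfun mu 2%:E -> g \in Lfun mu 2%:E ->
  h \in Lfun mu 2%:E -> dotL2 mu f (g \+ h) = dotL2 mu f g + dotL2 mu f h.
Proof.
move=> f2 g2 h2; rewrite /dotL2 -RintegralD//; try exact: Lfun2M_integrable.
by apply: eq_Rintegral => x _; rewrite mulrDr.
Qed.

Lemma dotL2Br f g h : f \in Lfun mu 2%:E -> g \in Lfun mu 2%:E ->
  h \in Lfun mu 2%:E -> dotL2 mu f (g \- h) = dotL2 mu f g - dotL2 mu f h.
Proof.
move=> f2 g2 h2; rewrite /dotL2 -RintegralB//; try exact: Lfun2M_integrable.
by apply: eq_Rintegral => x _; rewrite mulrBr.
Qed.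

Lemma dotL2_ae_eqr f g h : f \in Lfun mu 2%:E -> g \in Lfun mu 2%:E ->
  measurable_fun setT h -> g = h %[ae mu] -> dotL2 mu f g = dotL2 mu f h.
Proof.
move=> /Lfun2_measurable mf /Lfun2_measurable mg mh gh; congr fine.
apply: ae_eq_integral => //; try by apply/measurable_EFinP; exact: measurable_funM.
by apply: filterS gh => x /= /(_ I) -> _.
Qed.

Lemma dotL2_eq0 f : f \in Lfun mu 2%:E -> dotL2 mu f f = 0 -> f = cst 0 %[ae mu].
Proof.
move=> f2 f0; have mf := Lfun2_measurable f2.
have if2 := integrable_fin_num measurableT (Lfun2M_integrable f2 f2).
have /ae_eq_integral_abs : (\int[mu]_x `|(f x * f x)%:E| = 0)%E.
  under eq_integral => x _ do rewrite gee0_abs ?lee_fin -?expr2 ?sqr_ge0//.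
  by rewrite -(fineK if2); congr EFin.
have mff : measurable_fun setT (fun x => (f x * f x)%:E).
  by apply/measurable_EFinP; exact: measurable_funM.
move=> /(_ measurableT mff); apply: filterS => x /= /(_ I) [] /eqP.
by rewrite mulf_eq0 orbb => /eqP.
Qed.

Lemma ae_eq_Lfun2 f g : f \in Lfun mu 2%:E -> measurable_fun setT g ->
  f = g %[ae mu] -> g \in Lfun mu 2%:E.
Proof.
move=> /Lfun2P[mf f2] mg fg; apply/Lfun2P; split => //.
rewrite (ae_eq_integral (fun x => (f x ^+ 2)%:E))//.
- by apply/measurable_EFinP; exact: measurable_funX.
- by apply/measurable_EFinP; exact: measurable_funX.
- by apply: filterS fg => x /= /(_ I) -> _.
Qed.

Lemma expectation_ae_eq f g : measurable_fun setT f -> measurable_fun setT g ->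
  f = g %[ae mu] -> ('E_mu[f] = 'E_mu[g])%E.
Proof.
move=> mf mg fg; rewrite unlock; apply: ae_eq_integral => //.
- exact/measurable_EFinP.
- exact/measurable_EFinP.
- by apply: filterS fg => x /= /(_ I) -> _.
Qed.

Lemma ae_eq_L2_0 f g : L2_0 mu f -> measurable_fun setT g -> f = g %[ae mu] ->
  L2_0 mu g.
Proof.
move=> [f2 f0] mg fg; split; first exact: ae_eq_Lfun2 fg.
by rewrite -f0; apply/esym/expectation_ae_eq => //; exact: Lfun2_measurable.
Qed.

Lemma L2_0_cst0 : L2_0 mu (cst 0).
Proof. by split; [exact: Lfun_cst|rewrite expectation_cst]. Qed.

Lemma ae_eq0_dotL2r f g : f \in Lfun mu 2%:E -> g \in Lfun mu 2%:E ->
  g = cst 0 %[ae mu] -> dotL2 mu f g = 0.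
Proof.
move=> f2 g2 /(dotL2_ae_eqr f2 g2) ->//.
by rewrite /dotL2; under eq_Rintegral do rewrite mulr0; rewrite Rintegral_cst// mul0r.
Qed.

Lemma ae_eq_Lnorm2 f g : measurable_fun setT f -> measurable_fun setT g ->
  f = g %[ae mu] -> 'N[mu]_2%:E[EFin \o f]%E = 'N[mu]_2%:E[EFin \o g]%E.
Proof.
have m2 h : measurable_fun setT h ->
    measurable_fun setT (fun x => (`|(h x)%:E| `^ 2)%E).
  move=> mh; apply: (@measurableT_comp _ _ _ _ _ _ (fun x => x `^ 2)%E) => //=.
    exact: measurable_poweR.
  by apply/measurable_EFinP; exact: measurableT_comp.
move=> mf mg fg; rewrite unlock /Lnorm; congr (_ `^ _)%E.
apply: ae_eq_integral => //; [exact: m2|exact: m2|].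
by apply: filterS fg => x /= /(_ I) -> _.
Qed.

(** * Series of iterates of an operator on its kernel *)

Section vanishing_iterates.
Variable A : (T -> R) -> (T -> R).
Hypothesis A_L2_0 : forall f, L2_0 mu f -> L2_0 mu (A f).
Hypothesis A_ae0 : forall f, zero_space mu f -> A f = cst 0 %[ae mu].

(** [A] acts on representatives and [A f] is only a.e. zero, so [A_ae0] is what carries the
    vanishing from one iterate to the next. *)
Lemma iter_kernel_space f (h : nat) : kernel_space mu A f -> (1 <= h)%N ->
  zero_space mu (iter h A f).
Proof.
move=> [fL Af0]; elim: h => // -[_ _|h IH _]; first by split => //; exact: A_L2_0.
have /(_ isT) h0 := IH; split; last exact: A_ae0.
by apply: A_L2_0; case: h0.
Qed.

Lemma sum_iter_kernel_space f n : kernel_space mu A f ->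
  zero_space mu (\sum_(1 <= h < n.+1) iter h A f).
Proof.
move=> kf; rewrite big_nat; apply: (big_ind (zero_space mu)).
- by split; [exact: L2_0_cst0|exact: aeW].
- move=> u v [[u2 u0] uae] [[v2 v0] vae].
  have uvae : u \+ v = cst 0 %[ae mu].
    by apply: filterS2 uae vae => x + + _ => /= /(_ I) -> /(_ I) ->; rewrite addr0.
  split => //; apply: (@ae_eq_L2_0 (cst 0)); first exact: L2_0_cst0.
    by apply: measurable_funD; exact: Lfun2_measurable.
  exact: ae_eq_sym.
- by move=> h /andP[h1 _]; exact: iter_kernel_space.
Qed.

(** All partial sums are a.e. zero, so their distances to [s] form a constant sequence equal to the
    norm of [s]; it tends to 0 only if this norm is 0. *)
Lemma is_L2_sum_kernel_space f s : kernel_space mu A f ->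
  is_L2_sum mu (fun h : nat => iter h A f) s <-> zero_space mu s.
Proof.
move=> kf; rewrite /is_L2_sum.
have [sL|nsL] := pselect (L2_0 mu s); last by split => -[].
have ms : measurable_fun setT s by apply: Lfun2_measurable; case: sL.
have -> : (fun n => 'N[mu]_2%:E[EFin \o
    ((\sum_(1 <= i < n.+1) iter i A f) \- s)%R])%E = cst ('N[mu]_2%:E[EFin \o s])%E.
  apply/funext => n /=.
  have [[/Lfun2_measurable mS _] S0] := sum_iter_kernel_space n kf.
  rewrite (@ae_eq_Lnorm2 _ (\- s)).
  - by rewrite -(oppe_Lnorm mu (EFin \o s)).
  - exact: measurable_funB.
  - exact: measurableT_comp.
  - by apply: filterS S0 => x + _ => /= /(_ I) ->; rewrite sub0r.
split=> -[_ s0]; split => //.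
  have : 'N[mu]_2%:E[EFin \o s]%E = 0%E by move/cvg_lim : s0 => <- //; rewrite lim_cst.
  move/Lnorm_eq0_eq0 => /(_ _ _)/wrap[||]; [exact/measurable_EFinP|by []|].
  by apply: filterS => x /= /(_ I) [].
have -> : 'N[mu]_2%:E[EFin \o s]%E = 0%E.
  rewrite (@ae_eq_Lnorm2 _ (cst 0))// -[RHS](@Lnorm0 _ _ _ mu 2%:E)//.
exact: cvg_cst.
Qed.

End vanishing_iterates.

End L2_0_theory.

(** * Finite measures given by a density *)

Section density.
Context d (T : measurableType d) (R : realType) (mu : probability T R).
Variable f : T -> \bar R.
Hypotheses (fi : mu.-integrable setT f) (f0 : forall x, (0 <= f x)%E).
Local Open Scope ereal_scope.

(** The two proofs are arguments so that the measure structures declared below, which rely on them,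
    can be attached to the function. *)
Definition density_measure of mu.-integrable setT f & (forall x, 0 <= f x) :=
  fun A : set T => \int[mu]_(x in A) f x.
Local Notation nu := (density_measure fi f0).

Let nu0 : nu set0 = 0. Proof. exact: integral_set0. Qed.

Let nu_ge0 A : 0 <= nu A. Proof. exact: integral_ge0. Qed.

HB.instance Definition _ := isMeasure.Build _ _ _ nu nu0 nu_ge0
  (semi_sigma_additive_nng_induced (measurable_int mu fi) f0).

Let nu_fin : fin_num_fun nu.
Proof. by move=> A mA; apply: integrable_fin_num => //; exact: integrableS fi. Qed.

HB.instance Definition _ := Measure_isFinite.Build _ _ _ nu nu_fin.

Lemma density_measure_dominates : nu `<< mu.
Proof.
apply/null_content_dominatesP => A mA muA0; apply: null_set_integral => //.
exact/measurable_funTS/(measurable_int mu).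
Qed.

(** [f] and the Radon-Nikodym derivative of the measure have the same integral over every measurable
    set, hence agree a.e.; the change of variables for the derivative then passes to [f]. *)
Lemma ge0_integral_density (g : T -> \bar R) : measurable_fun setT g ->
  (forall x, 0 <= g x) -> \int[nu]_x g x = \int[mu]_x (g x * f x).
Proof.
move=> mg g0; have mf := measurable_int mu fi.
pose RN := Radon_Nikodym_SigmaFinite.f nu mu.
have RNi : mu.-integrable setT RN.
  exact/Radon_Nikodym_SigmaFinite.f_integrable/density_measure_dominates.
rewrite -(Radon_Nikodym_SigmaFinite.change_of_variables density_measure_dominates)//.
apply: ae_eq_integral => //.
- exact: (emeasurable_funM mg (measurable_int mu RNi)).
- exact: emeasurable_funM.
apply/ae_eqe_mul2l/integral_ae_eq => // A _ mA.
rewrite -Radon_Nikodym_SigmaFinite.f_integral//.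
exact: density_measure_dominates.
Qed.

End density.

(** * Images of finite measures *)

Section finite_pushforward.
Context d d' (T : measurableType d) (S : measurableType d') (R : realType).
Variables (mu : {finite_measure set T -> \bar R}) (X : {mfun T >-> S}).

Definition finite_pushforward := pushforward mu X.

Let finite_pushforward0 : finite_pushforward set0 = 0%E.
Proof. exact: measure0. Qed.

Let finite_pushforward_ge0 A : (0 <= finite_pushforward A)%E.
Proof. exact: measure_ge0. Qed.

Let finite_pushforward_additive : semi_sigma_additive finite_pushforward.
Proof. exact: measure_semi_sigma_additive. Qed.

HB.instance Definition _ := isMeasure.Build _ _ _ finite_pushforward
  finite_pushforward0 finite_pushforward_ge0 finite_pushforward_additive.

Let finite_pushforward_fin : fin_num_fun finite_pushforward.
Proof.
move=> A mA; apply: (fin_num_measure mu).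
by rewrite -[X @^-1` A]setTI; exact: measurable_funPT.
Qed.

HB.instance Definition _ :=
  Measure_isFinite.Build _ _ _ finite_pushforward finite_pushforward_fin.

End finite_pushforward.

(** * Conditional expectation of square-integrable functions given a random variable *)

Section conditional_expectation.
Context d d' (T : measurableType d) (S : measurableType d') (R : realType).
Variables (mu : probability T R) (X : {RV mu >-> S}).

(** Here [w] is the Radon-Nikodym derivative, with respect to the law of [X], of the image under [X]
    of the measure with density [f]. Nonnegative test functions make all integrals meaningful before
    [w] is known to be square-integrable. *)
Lemma ge0_conditional_expectation (f : T -> R) :
    mu.-integrable setT (EFin \o f) -> (forall x, 0 <= f x) ->
  exists w : S -> R, [/\ measurable_fun setT w, forall s, 0 <= w s &
    forall v : S -> \bar R, measurable_fun setT v -> (forall s, 0 <= v s)%E ->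
      (\int[mu]_x (v (X x) * (f x)%:E) = \int[mu]_x (v (X x) * (w (X x))%:E))%E].
Proof.
move=> fi f0; have f0' x : (0 <= (EFin \o f) x)%E by rewrite lee_fin.
pose rho : probability S R := distribution mu X.
pose nu : {finite_measure set S -> \bar R} :=
  finite_pushforward (density_measure fi f0') X.
have nu_rho : nu `<< rho.
  apply/null_content_dominatesP => A mA rhoA0.
  have /null_content_dominatesP := density_measure_dominates fi f0'.
  by apply => //; rewrite -[X @^-1` A]setTI; exact: measurable_funPT.
pose RN := Radon_Nikodym_SigmaFinite.f nu rho.
have RNi : rho.-integrable setT RN by exact: Radon_Nikodym_SigmaFinite.f_integrable.
have RN0 s : (0 <= RN s)%E by exact: Radon_Nikodym_SigmaFinite.f_ge0.
have RNfin s : RN s \is a fin_num by exact: Radon_Nikodym_SigmaFinite.f_fin_num.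
have mRN : measurable_fun setT RN := measurable_int rho RNi.
exists (fine \o RN); split => [|s|v mv v0].
- by apply: measurableT_comp.
- by apply: fine_ge0.
under [RHS]eq_integral do rewrite fineK//.
rewrite -(@ge0_integral_distribution _ _ _ _ _ mu X (fun s => v s * RN s)%E)//; last first.
- by move=> s; rewrite mule_ge0.
- exact: emeasurable_funM.
rewrite Radon_Nikodym_SigmaFinite.change_of_variables//.
rewrite ge0_integral_pushforward//.
rewrite preimage_setT -ge0_integral_density//.
exact: measurableT_comp.
Qed.

(** The truncations of [w] have L^2 norm at most that of [f], so [w \o X] is square-integrable and
    signed test functions become admissible. *)
Lemma ge0_conditional_expectation_Lfun2 (f : T -> R) :
    f \in Lfun mu 2%:E -> (forall x, 0 <= f x) ->
  exists w : S -> R, [/\ measurable_fun setT w, w \o X \in Lfun mu 2%:E &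
    forall v : S -> R, measurable_fun setT v -> v \o X \in Lfun mu 2%:E ->
      dotL2 mu (v \o X) f = dotL2 mu (v \o X) (w \o X)].
Proof.
move=> f2 f0; have mf := Lfun2_measurable f2.
have [w [mw w0 wE]] := ge0_conditional_expectation (Lfun2_integrable f2) f0.
have mwX : measurable_fun setT (w \o X) by exact: measurableT_comp.
have wX2 : w \o X \in Lfun mu 2%:E.
  pose A (n : nat) : set T := [set x | w (X x) <= n%:R].
  have mA n : measurable (A n).
    rewrite -[A n]setTI.
    exact: (mwX measurableT [set r | r <= n%:R] (measurable_itv `]-oo, n%:R])).
  have Abound n : (\int[mu]_(x in A n) (w (X x) ^+ 2)%:E <=
                   \int[mu]_x (f x ^+ 2)%:E)%E.
    (* v is bounded, and v^2 = v w gives <v, v> = <v, w> = <v, f>, so the L^2 norm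
       of v o X is at most that of f. *)
    pose v s : R := if w s <= n%:R then w s else 0.
    have mv : measurable_fun setT v.
      by apply: measurable_fun_ifT => //; exact: measurable_fun_ler.
    have mvX : measurable_fun setT (v \o X) by exact: measurableT_comp.
    have v0 s : 0 <= v s by rewrite /v; case: ifP.
    have vX2 : v \o X \in Lfun mu 2%:E.
      apply/Lfun2P; split => //.
      have cst_lty : (\int[mu]_x (cst (n%:R ^+ 2)%:E x) < +oo)%E.
        by rewrite integral_cst// [X in (_ * X)%E]probability_setT mule1 ltry.
      apply: le_lt_trans cst_lty; apply: ge0_le_integral => //.
      - by move=> x _; rewrite lee_fin sqr_ge0.
      - by apply/measurable_EFinP; exact: measurable_funX.
      - move=> x _; rewrite lee_fin /= /v; case: ifPn => [wn|_].
          by rewrite lerXn2r// nnegrE.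
        by rewrite expr0n/= sqr_ge0.
    have vw x : (v (X x) ^+ 2)%:E = ((v (X x))%:E * (w (X x))%:E)%E.
      by rewrite -EFinM /v; case: ifPn => _; rewrite ?expr2// mulr0 mul0r.
    have vf : dotL2 mu (v \o X) f = dotL2 mu (v \o X) (v \o X).
      congr fine; under [RHS]eq_integral do rewrite -expr2 vw.
      under [LHS]eq_integral do rewrite EFinM.
      by apply: (wE (EFin \o v)) => //; exact/measurable_EFinP.
    rewrite integral_mkcond (eq_integral (fun x => (v (X x) * v (X x))%:E)).
      under [leRHS]eq_integral do rewrite expr2.
      rewrite (dotL2E vX2 vX2) dotL2E// lee_fin.
      have := dotL2_ge0 mu (f \- (v \o X)).
      rewrite dotL2Br ?Lfun2B// [dotL2 _ _ f]dotL2C [dotL2 _ (f \- _) _]dotL2C.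
      by rewrite !dotL2Br// [dotL2 mu f (v \o X)]dotL2C vf subrr subr0 subr_ge0.
    move=> x _; rewrite patchE /v -expr2; case: ifPn => [/set_mem/= ->//|].
    by move/negP; rewrite in_setE /A/= => /negP/negbTE ->; rewrite expr0n.
  apply/Lfun2P; split => //.
  apply: le_lt_trans (integrable_lty measurableT (Lfun2_integrable_sqr f2)).
  (* As [w] takes finite values, the sets [A n] increase to the whole space, and the uniform bound
     survives the limit by monotone convergence. *)
  have AT : \bigcup_n A n = setT.
    apply/seteqP; split => // x _; exists (Num.truncn (w (X x))).+1 => //=.
    by rewrite /A /= ltW//; have /andP[] := truncn_itv (w0 (X x)).
  rewrite -AT.
  apply: cvge_le (ge0_nondecreasing_set_cvg_integral _ mA _ _).
  - by apply: nearW => n; rewrite AT; exact: Abound.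
  - move=> m n mn; apply/subsetPset => x; rewrite /A/= => /le_trans; apply.
    by rewrite ler_nat.
  - by move=> n; apply/measurable_funTS/measurable_EFinP; exact: measurable_funX.
  - by move=> n x _; rewrite lee_fin sqr_ge0.
exists w; split => // v mv v2.
have nonneg_case u : measurable_fun setT u -> u \o X \in Lfun mu 2%:E ->
    (forall s, 0 <= u s) -> dotL2 mu (u \o X) f = dotL2 mu (u \o X) (w \o X).
  move=> mu' u2 u0; congr fine.
  under eq_integral do rewrite EFinM.
  under [RHS]eq_integral do rewrite EFinM.
  by apply: (wE (EFin \o u)) => [|s]; [exact/measurable_EFinP|rewrite lee_fin].
have mnv : measurable_fun setT (fun s => `|v s|) by exact: measurableT_comp.
have nv2 : (fun s => `|v s|) \o X \in Lfun mu 2%:E := Lfun2_norm v2.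
have nvv2 : (fun s => `|v s| - v s) \o X \in Lfun mu 2%:E := Lfun2B nv2 v2.
(* v is the difference of the nonnegative functions |v| and |v| - v. *)
have split_v h : h \in Lfun mu 2%:E -> dotL2 mu (v \o X) h =
    dotL2 mu ((fun s => `|v s|) \o X) h - dotL2 mu ((fun s => `|v s| - v s) \o X) h.
  move=> h2; rewrite ![dotL2 mu _ h]dotL2C -dotL2Br//; congr dotL2.
  by apply/funext => x /=; rewrite subKr.
rewrite split_v// [RHS]split_v//; congr (_ - _); first exact: nonneg_case.
apply: nonneg_case => //; first exact: measurable_funB.
by move=> s; rewrite subr_ge0 ler_norm.
Qed.

(** By linearity, from the nonnegative functions [|f|] and [|f| - f], whose difference is [f]. *)
Lemma conditional_expectation_Lfun2 (f : T -> R) :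
    f \in Lfun mu 2%:E ->
  exists w : S -> R, [/\ measurable_fun setT w, w \o X \in Lfun mu 2%:E &
    forall v : S -> R, measurable_fun setT v -> v \o X \in Lfun mu 2%:E ->
      dotL2 mu (v \o X) f = dotL2 mu (v \o X) (w \o X)].
Proof.
move=> f2; have nf2 := Lfun2_norm f2.
have [w1 [mw1 w12 w1E]] := ge0_conditional_expectation_Lfun2 nf2 (fun x => normr_ge0 _).
have nff0 x : 0 <= ((fun x => `|f x|) \- f) x by rewrite subr_ge0 ler_norm.
have [w2 [mw2 w22 w2E]] := ge0_conditional_expectation_Lfun2 (Lfun2B nf2 f2) nff0.
exists (w1 \- w2); split; [exact: measurable_funB|exact: Lfun2B|move=> v mv v2].
rewrite [RHS](_ : _ = dotL2 mu (v \o X) ((w1 \o X) \- (w2 \o X)))//.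
rewrite dotL2Br// -w1E// -w2E// dotL2Br ?Lfun2B//.
by rewrite subKr.
Qed.

End conditional_expectation.

(** * Positive and negative parts of compositions, and Jensen's inequality for the square *)

Lemma funepos_comp A B (R : realDomainType) (g : A -> B) (f : B -> \bar R) :
  (fun x => f (g x))^\+%E = fun x => f^\+%E (g x).
Proof. by apply/funext => x; rewrite !funeposE. Qed.

Lemma funeneg_comp A B (R : realDomainType) (g : A -> B) (f : B -> \bar R) :
  (fun x => f (g x))^\-%E = fun x => f^\-%E (g x).
Proof. by apply/funext => x; rewrite !funenegE. Qed.

(** With [c] the mean of [f], this is the nonnegativity of the variance <f - c, f - c> = <f, f> -
    c^2; when the right-hand side is infinite there is nothing to prove. *)
Lemma sqr_Rintegral_le d (T : measurableType d) (R : realType)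
    (mu : probability T R) (f : T -> R) : measurable_fun setT f ->
  (((\int[mu]_x f x) ^+ 2)%:E <= \int[mu]_x (f x ^+ 2)%:E)%E.
Proof.
move=> mf; have [foo|] := ltP (\int[mu]_x (f x ^+ 2)%:E)%E +oo%E; last first.
  by rewrite leye_eq => /eqP ->; exact: leey.
have f2 : f \in Lfun mu 2%:E by apply/Lfun2P.
set c := \int[mu]_x f x.
have c2 : cst c \in Lfun mu 2%:E by exact: Lfun_cst.
have fc : dotL2 mu f (cst c) = c ^+ 2.
  by rewrite /dotL2 RintegralZr ?expr2//; exact: Lfun2_integrable.
have cc : dotL2 mu (cst c) (cst c) = c ^+ 2.
  rewrite -[LHS]/(\int[mu]_x (c * c)) Rintegral_cst//.
  by rewrite [X in fine X]probability_setT mulr1 expr2.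
under eq_integral do rewrite expr2; rewrite dotL2E// lee_fin.
have := dotL2_ge0 mu (f \- cst c).
rewrite dotL2Br ?Lfun2B// [dotL2 _ (f \- _) f]dotL2C [dotL2 _ (f \- _) _]dotL2C.
rewrite !dotL2Br// [dotL2 mu (cst c) f]dotL2C fc cc subrr subr0 subr_ge0.
by [].
Qed.

Lemma expectation_dotL2 d (T : measurableType d) (R : realType)
    (mu : probability T R) (f : T -> R) : f \in Lfun mu 2%:E ->
  ('E_mu[f] = (dotL2 mu (cst 1) f)%:E)%E.
Proof.
move=> f2; rewrite unlock -dotL2E//; last exact: Lfun_cst.
by under [RHS]eq_integral do rewrite mul1r.
Qed.

Section kernel_at.
Context d1 d2 (S : measurableType d1) (E : measurableType d2) (R : realType).
Variables (q : R.-pker S ~> E) (s : S).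

(** Naming the measure [q s] lets it carry a probability structure, so that Jensen's inequality
    applies to it. *)
Definition kernel_at : set E -> \bar R := q s.

HB.instance Definition _ := Measure.on kernel_at.

HB.instance Definition _ :=
  Measure_isProbability.Build _ _ _ kernel_at (prob_kernel s).

End kernel_at.

(** * The one-step operator and its adjoint, for abstract front and rear projections *)

Section one_step.
Context d1 d2 d3 (T : measurableType d1) (S : measurableType d2)
  (E : measurableType d3) (R : realType).
Variables (pi : probability T R) (front rear : {mfun T >-> S}).
Variables (q : R.-pker S ~> E) (step : S * E -> T).
Hypothesis measurable_step : measurable_fun setT step.
Hypothesis front_step : forall s z, front (step (s, z)) = s.
Hypothesis front_rear : forall A, measurable A ->
  distribution pi front A = distribution pi rear A.
Hypothesis disintegration : forall phi : T -> \bar R,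
  measurable_fun setT phi -> (forall x, 0 <= phi x)%E ->
  (\int[pi]_x phi x = \int[pi]_x \int[q (front x)]_z phi (step (front x, z)))%E.

(** By [dotL2_condexp] below, [condexp f \o front] is a version of the conditional expectation of
    [f] given [front]. *)
Definition condexp (f : T -> R) (s : S) : R := \int[q s]_z f (step (s, z)).

Definition one_step (f : T -> R) (x : T) : R := condexp f (rear x).

Let mstep s : measurable_fun setT (fun z => step (s, z)).
Proof. exact: (measurableT_comp measurable_step). Qed.

Lemma integral_front_rear (phi : S -> \bar R) : measurable_fun setT phi ->
  (\int[pi]_x phi (front x) = \int[pi]_x phi (rear x))%E.
Proof.
have ge0 (psi : S -> \bar R) : measurable_fun setT psi -> (forall s, 0 <= psi s)%E ->
    (\int[pi]_x psi (front x) = \int[pi]_x psi (rear x))%E.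
  move=> mpsi psi0.
  rewrite -(ge0_integral_distribution front mpsi psi0).
  rewrite -(ge0_integral_distribution rear mpsi psi0).
  by apply: eq_measure_integral => A mA _; exact: front_rear.
move=> mphi; rewrite integralE [RHS]integralE; congr (_ - _)%E.
- by rewrite (funepos_comp front) (funepos_comp rear); apply: ge0 => //; exact: measurable_funepos.
- by rewrite (funeneg_comp front) (funeneg_comp rear); apply: ge0 => //; exact: measurable_funeneg.
Qed.

Lemma dotL2_front_rear (u v : S -> R) : measurable_fun setT u ->
  measurable_fun setT v ->
  dotL2 pi (u \o front) (v \o front) = dotL2 pi (u \o rear) (v \o rear).
Proof.
move=> mu mv; congr fine.
apply: (integral_front_rear (phi := fun s => (u s * v s)%:E)).
by apply/measurable_EFinP; exact: measurable_funM.
Qed.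

Lemma Lfun2_front_rear (u : S -> R) : measurable_fun setT u ->
  (u \o front \in Lfun pi 2%:E) <-> (u \o rear \in Lfun pi 2%:E).
Proof.
move=> mu; rewrite !Lfun2P.
rewrite (integral_front_rear (phi := fun s => (u s ^+ 2)%:E)).
  by split => -[_ ?]; split => //; exact: measurableT_comp.
by apply/measurable_EFinP; exact: measurable_funX.
Qed.

Lemma L2_0_front_rear (u : S -> R) : measurable_fun setT u ->
  L2_0 pi (u \o front) <-> L2_0 pi (u \o rear).
Proof.
move=> mu.
have Epn : ('E_pi[u \o front] = 'E_pi[u \o rear])%E.
  by rewrite unlock; apply: (integral_front_rear (phi := EFin \o u)); exact/measurable_EFinP.
have [pn np] := Lfun2_front_rear mu.
split=> -[u2 u0].
- by split; [exact: pn|rewrite -Epn].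
- by split; [exact: np|rewrite Epn].
Qed.

Let measurable_kernel_integral (phi : T -> \bar R) : measurable_fun setT phi ->
  measurable_fun setT (fun s => \int[q s]_z phi (step (s, z)))%E.
Proof.
move=> mphi; under eq_fun do rewrite integralE funepos_comp funeneg_comp.
apply: emeasurable_funB.
- apply: (measurable_fun_integral_finite_kernel (fun sz => phi^\+ (step sz))%E) => //.
  by apply: measurableT_comp => //; exact: measurable_funepos.
- apply: (measurable_fun_integral_finite_kernel (fun sz => phi^\- (step sz))%E) => //.
  by apply: measurableT_comp => //; exact: measurable_funeneg.
Qed.

Lemma measurable_condexp f : measurable_fun setT f -> measurable_fun setT (condexp f).
Proof.
move=> mf; apply: measurableT_comp => //.
by apply: (@measurable_kernel_integral (EFin \o f)); exact/measurable_EFinP.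
Qed.

Lemma sqr_condexp_le f s : measurable_fun setT f ->
  ((condexp f s ^+ 2)%:E <= \int[q s]_z (f (step (s, z)) ^+ 2)%:E)%E.
Proof.
move=> mf; apply: (@sqr_Rintegral_le _ _ _ (kernel_at q s)).
exact: measurableT_comp.
Qed.

(** Jensen's inequality in each fibre, followed by the disintegration of [f ^+ 2]. *)
Lemma integral_sqr_condexp_le f : measurable_fun setT f ->
  (\int[pi]_x (condexp f (front x) ^+ 2)%:E <= \int[pi]_x (f x ^+ 2)%:E)%E.
Proof.
move=> mf; have mf2 : measurable_fun setT (fun x => (f x ^+ 2)%:E).
  by apply/measurable_EFinP; exact: measurable_funX.
rewrite (disintegration mf2); last by move=> x; rewrite lee_fin sqr_ge0.
apply: ge0_le_integral => //.
- by move=> x _; rewrite lee_fin sqr_ge0.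
- apply/measurable_EFinP/measurable_funX.
  exact: (measurableT_comp (measurable_condexp mf)).
- exact: (measurableT_comp (measurable_kernel_integral mf2)).
- by move=> x _; exact: sqr_condexp_le.
Qed.

Lemma condexp_front_Lfun2 f : f \in Lfun pi 2%:E ->
  condexp f \o front \in Lfun pi 2%:E.
Proof.
move=> /Lfun2P[mf f2]; apply/Lfun2P; split.
  exact: (measurableT_comp (measurable_condexp mf)).
exact: le_lt_trans (integral_sqr_condexp_le mf) f2.
Qed.

Lemma condexp_front (u : S -> R) : condexp (u \o front) = u.
Proof.
apply/funext => s; rewrite /condexp /=.
under eq_Rintegral do rewrite front_step.
by rewrite Rintegral_cst// prob_kernel mulr1.
Qed.

Lemma integral_disintegration (f : T -> R) : pi.-integrable setT (EFin \o f) ->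
  (\int[pi]_x (f x)%:E =
   \int[pi]_x \int[q (front x)]_z (f (step (front x, z)))%:E)%E.
Proof.
move=> fi; have mf := measurable_int pi fi.
pose fp : T -> \bar R := (EFin \o f)^\+%E.
pose fn : T -> \bar R := (EFin \o f)^\-%E.
have mfp : measurable_fun setT fp by exact: measurable_funepos.
have mfn : measurable_fun setT fn by exact: measurable_funeneg.
(* Integrability of the fibre integrals of both parts is what allows their difference to be
   recombined under one integral. *)
have int_kernel (g : T -> \bar R) : measurable_fun setT g -> (forall x, 0 <= g x)%E ->
    pi.-integrable setT g ->
    pi.-integrable setT (fun x => \int[q (front x)]_z g (step (front x, z)))%E.
  move=> mg g0 gi; apply/integrableP; split.
    exact: (measurableT_comp (measurable_kernel_integral mg)).
  under eq_integral => x _ do rewrite gee0_abs ?integral_ge0//.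
  rewrite -disintegration//.
  exact: integrable_lty.
transitivity (\int[pi]_x fp x - \int[pi]_x fn x)%E; first by rewrite integralE.
under [RHS]eq_integral => x _.
  rewrite integralE (funepos_comp (fun z => step (front x, z)) (EFin \o f)).
  rewrite (funeneg_comp (fun z => step (front x, z)) (EFin \o f)); over.
have fp0 x : (0 <= fp x)%E by exact: funepos_ge0.
have fn0 x : (0 <= fn x)%E by exact: funeneg_ge0.
rewrite (disintegration mfp fp0) (disintegration mfn fn0) -integralB//.
- by apply: int_kernel => //; exact: integrable_funepos.
- by apply: int_kernel => //; exact: integrable_funeneg.
Qed.

(** On the fibre over [front x], the function [u \o front] is the constant [u (front x)] and leaves
    the inner integral. *)
Lemma dotL2_condexp (u : S -> R) f : measurable_fun setT u ->
  u \o front \in Lfun pi 2%:E -> f \in Lfun pi 2%:E ->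
  dotL2 pi (u \o front) f = dotL2 pi (u \o front) (condexp f \o front).
Proof.
move=> mu u2 f2; congr fine; have mf := Lfun2_measurable f2.
have muf := measurable_int pi (Lfun2M_integrable u2 f2).
rewrite (integral_disintegration (Lfun2M_integrable u2 f2)).
apply: ae_eq_integral => //.
- exact: (measurableT_comp (measurable_kernel_integral muf)).
- apply/measurable_EFinP/measurable_funM; first exact: measurableT_comp.
  exact: (measurableT_comp (measurable_condexp mf)).
have mnf : measurable_fun setT (fun x => `|(f x)%:E|%E).
  by apply: measurableT_comp => //; exact/measurable_EFinP.
(* Disintegrating [|f|] shows that [f] is integrable on almost every fibre, as pulling the constant
   out requires. *)
have : pi.-integrable setT
    (fun x => \int[q (front x)]_z `|(f (step (front x, z)))%:E|)%E.
  apply/integrableP; split.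
    exact: (measurableT_comp (measurable_kernel_integral mnf)).
  under eq_integral => x _ do rewrite gee0_abs ?integral_ge0//.
  rewrite -(disintegration mnf)//.
  by have /integrableP[] := Lfun2_integrable f2.
move/(integrable_ae measurableT); apply: filterS => x /= /(_ I) fin _.
have fi : (q (front x)).-integrable setT (fun z => (f (step (front x, z)))%:E).
  apply/integrableP; split.
    by apply/measurable_EFinP; exact: measurableT_comp.
  by rewrite -ge0_fin_numE ?integral_ge0.
under eq_integral do rewrite front_step EFinM.
rewrite integralZl// EFinM fineK//.
exact: integrable_fin_num.
Qed.

(** Square-integrability and mean pass from (C f) o front to (C f) o rear by equality of laws, and
    the mean of (C f) o front is <1, f> = 0. *)
Lemma one_step_L2_0 f : L2_0 pi f -> L2_0 pi (one_step f).
Proof.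
move=> [f2 f0]; have mf := Lfun2_measurable f2.
apply: (L2_0_front_rear (measurable_condexp mf)).1; split.
  exact: condexp_front_Lfun2.
rewrite expectation_dotL2; last exact: condexp_front_Lfun2.
rewrite -[cst 1]/((cst 1 : S -> R) \o front) -dotL2_condexp//; last exact: Lfun_cst.
by rewrite -f0 expectation_dotL2.
Qed.

(** <P f, P f> = <(C f) o front, (C f) o front> = <(C f) o front, f> = 0. *)
Lemma one_step_ae0 f : zero_space pi f -> one_step f = cst 0 %[ae pi].
Proof.
move=> [fL fae]; have [f2 _] := fL; have mf := Lfun2_measurable f2.
have [Pf2 _] := one_step_L2_0 fL.
apply: (dotL2_eq0 Pf2).
rewrite -(dotL2_front_rear (measurable_condexp mf) (measurable_condexp mf)).
rewrite -dotL2_condexp//; first exact: ae_eq0_dotL2r (condexp_front_Lfun2 f2) f2 fae.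
- exact: measurable_condexp.
- exact: condexp_front_Lfun2.
Qed.

(* With C f = condexp f, one has P f = (C f) o rear and P^* f = w o front, where
   w o rear is the conditional expectation of f given rear. *)
Lemma adjoint_one_step_ex f : L2_0 pi f -> exists g, L2_0 pi g /\
  forall h, L2_0 pi h -> dotL2 pi h g = dotL2 pi (one_step h) f.
Proof.
move=> [f2 f0]; have [w [mw w2 wE]] := conditional_expectation_Lfun2 rear f2.
have wp2 : w \o front \in Lfun pi 2%:E by exact/Lfun2_front_rear.
exists (w \o front); split.
  apply/L2_0_front_rear => //; split => //.
  rewrite expectation_dotL2// -[cst 1]/((cst 1 : S -> R) \o rear) -wE//; last exact: Lfun_cst.
  by rewrite -f0 expectation_dotL2.
move=> h [h2 _]; have mh := Lfun2_measurable h2.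
rewrite dotL2C dotL2_condexp// dotL2_front_rear//; last exact: measurable_condexp.
rewrite dotL2C -wE//; first exact: measurable_condexp.
by apply/Lfun2_front_rear; [exact: measurable_condexp|exact: condexp_front_Lfun2].
Qed.

Lemma adjoint_one_stepP f : L2_0 pi f -> L2_0 pi (adjoint pi one_step f) /\
  forall h, L2_0 pi h -> dotL2 pi h (adjoint pi one_step f) = dotL2 pi (one_step h) f.
Proof. by move=> /adjoint_one_step_ex /(xgetPex (cst 0)). Qed.

(** The adjoint is only known through its defining identity, which gives <P^* f, P^* f> = <P P^* f,
    f> = 0. *)
Lemma adjoint_one_step_ae0 f : zero_space pi f ->
  adjoint pi one_step f = cst 0 %[ae pi].
Proof.
move=> [fL f0]; have [[g2 g0] gE] := adjoint_one_stepP fL.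
apply: dotL2_eq0 => //; rewrite gE//.
by apply: ae_eq0_dotL2r => //; [case: (one_step_L2_0 (conj g2 g0))|case: fL].
Qed.

(** Common form of [left_space] and [right_space], obtained for [drop_last] and [drop_first]. *)
Definition functions_of (X : T -> S) : set (T -> R) :=
  [set f | L2_0 pi f /\ exists u : S -> R,
     measurable_fun setT u /\ f = u \o X %[ae pi]].

Lemma functions_of_cst0 X : functions_of X (cst 0).
Proof. by split; [exact: L2_0_cst0|exists (cst 0); split => //; exact: aeW]. Qed.

Lemma incremental_kernel :
  orthogonal_space pi (sum_space (functions_of front) (functions_of rear)) =
  kernel_space pi one_step `&` kernel_space pi (adjoint pi one_step).
Proof.
apply/seteqP; split => f.
- move=> [fL forth]; have [f2 _] := fL; have mf := Lfun2_measurable f2.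
  have mCf := measurable_condexp mf.
  have orthL v : functions_of front v -> dotL2 pi f v = 0.
    move=> vL; apply: forth; exists v => //; exists (cst 0).
      exact: functions_of_cst0.
    by apply/funext => x /=; rewrite addr0.
  have orthR v : functions_of rear v -> dotL2 pi f v = 0.
    move=> vR; apply: forth; exists (cst 0); first exact: functions_of_cst0.
    by exists v => //; apply/funext => x /=; rewrite add0r.
  split; split => //.
    (* <P f, P f> = <(C f) o front, f>, which vanishes since (C f) o front is a function of
       [front]. *)
    have [Pf2 _] := one_step_L2_0 fL; apply: (dotL2_eq0 Pf2).
    rewrite -dotL2_front_rear// -dotL2_condexp//; last exact: condexp_front_Lfun2.
    rewrite dotL2C; apply: orthL; split; last by exists (condexp f); split => //; exact: aeW.
    by apply/L2_0_front_rear => //; exact: one_step_L2_0.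
  have [gL gE] := adjoint_one_stepP fL; have [g2 _] := gL.
  (* With g = P^* f, <g, g> = <P g, f>, which vanishes since P g is a function of [rear]. *)
  apply: (dotL2_eq0 g2); rewrite gE// dotL2C; apply: orthR; split.
    exact: one_step_L2_0.
  exists (condexp (adjoint pi one_step f)); split; last exact: aeW.
  by apply: measurable_condexp; exact: Lfun2_measurable g2.
- move=> [[fL Pf0] [_ Psf0]]; split => // _ [v [vL [u [mu vu]]] [w [wL [u' [mu' wu']]] ->]].
  have [f2 _] := fL; have mf := Lfun2_measurable f2.
  have [v2 _] := vL; have [w2 _] := wL.
  have uL : L2_0 pi (u \o front) by apply: ae_eq_L2_0 vL _ vu; exact: measurableT_comp.
  have u'L : L2_0 pi (u' \o rear) by apply: ae_eq_L2_0 wL _ wu'; exact: measurableT_comp.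
  have [u2 _] := uL.
  (* (C f) o front has the same norm as (C f) o rear = P f, namely 0. *)
  have Cf0 : condexp f \o front = cst 0 %[ae pi].
    apply: dotL2_eq0; first exact: condexp_front_Lfun2.
    rewrite dotL2_front_rear; [|exact: measurable_condexp..].
    by case: (one_step_L2_0 fL) => Pf2 _; exact: ae_eq0_dotL2r.
  rewrite dotL2Dr// (dotL2_ae_eqr f2 v2 _ vu); last exact: measurableT_comp.
  rewrite (dotL2_ae_eqr f2 w2 _ wu'); last exact: measurableT_comp.
  rewrite [X in X + _]dotL2C dotL2_condexp//.
  rewrite (ae_eq0_dotL2r u2 _ Cf0) ?add0r; last exact: condexp_front_Lfun2.
  have u'pL : L2_0 pi (u' \o front) by apply/L2_0_front_rear.
  have [gL gE] := adjoint_one_stepP fL.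
  (* Since C (u' o front) = u', the function u' o rear is P (u' o front), and its product with f is
     <u' o front, P^* f>. *)
  rewrite dotL2C -[u' \o rear](_ : one_step (u' \o front) = _); last first.
    by apply/funext => x; rewrite /one_step condexp_front.
  rewrite -gE//.
  by apply: ae_eq0_dotL2r => //; [case: u'pL|case: gL].
Qed.

End one_step.

(** * The Green-Kubo operator on the intersection of the two kernels *)

Section green_kubo_kernel.
Context d (T : measurableType d) (R : realType) (mu : probability T R).
Variable A : (T -> R) -> (T -> R).
Hypothesis A_L2_0 : forall f, L2_0 mu f -> L2_0 mu (A f).
Hypothesis A_ae0 : forall f, zero_space mu f -> A f = cst 0 %[ae mu].
Hypothesis adjA_L2_0 : forall f, L2_0 mu f -> L2_0 mu (adjoint mu A f).
Hypothesis adjA_ae0 : forall f, zero_space mu f -> adjoint mu A f = cst 0 %[ae mu].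

(** [L2_sum] chooses some sum of each series; on the kernels every sum is a.e. zero, so only the
    term [f] is left whatever the choice. *)
Lemma green_kubo_kernel f :
  kernel_space mu A f -> kernel_space mu (adjoint mu A) f ->
  green_kubo_domain mu A f /\ green_kubo mu A f = f %[ae mu].
Proof.
move=> kf kadjf.
have z0 : zero_space mu (cst 0) by split; [exact: L2_0_cst0|exact: aeW].
have sA := (is_L2_sum_kernel_space A_L2_0 A_ae0 (cst 0) kf).2 z0.
have sadjA := (is_L2_sum_kernel_space adjA_L2_0 adjA_ae0 (cst 0) kadjf).2 z0.
split; first by split; [case: kf|exists (cst 0)|exists (cst 0)].
have /(is_L2_sum_kernel_space A_L2_0 A_ae0 _ kf)[_ s0] :=
  xgetPex (cst 0) (ex_intro _ _ sA).
have /(is_L2_sum_kernel_space adjA_L2_0 adjA_ae0 _ kadjf)[_ s0'] :=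
  xgetPex (cst 0) (ex_intro _ _ sadjA).
apply: filterS2 s0 s0' => x /(_ I) sx /(_ I) sx' _.
by rewrite /green_kubo /L2_sum /= sx sx' /= !addr0.
Qed.

End green_kubo_kernel.

(** * Kernels read through a map, and conditional laws *)

Section kernel_comp.
Context d1 d2 d3 (X : measurableType d1) (Y : measurableType d2)
  (Z : measurableType d3) (R : realType).
Variables (q : R.-pker Y ~> Z) (g : {mfun X >-> Y}).

(** Used with [last_state], to let a transition from a whole window depend on its last coordinate,
    and with a projection forgetting a dummy coordinate. *)
Definition kernel_comp (x : X) : {measure set Z -> \bar R} := q (g x).

Let measurable_kernel_comp U : measurable U ->
  measurable_fun setT (kernel_comp ^~ U).
Proof.
by move=> mU; apply: (measurableT_comp (measurable_kernel q U mU)).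
Qed.

HB.instance Definition _ :=
  isKernel.Build _ _ _ _ _ kernel_comp measurable_kernel_comp.

Let kernel_comp_prob x : kernel_comp x setT = 1%E.
Proof. exact: prob_kernel. Qed.

HB.instance Definition _ :=
  Kernel_isProbability.Build _ _ _ _ _ kernel_comp kernel_comp_prob.

End kernel_comp.

Section conditional_law.
Context d d1 d2 (Omega : measurableType d) (S : measurableType d1)
  (E : measurableType d2) (R : realType).
Variables (Pr : probability Omega R) (U : {RV Pr >-> S}) (V : {RV Pr >-> E}).
Variable q : R.-pker S ~> E.
Hypothesis UV_law : forall A B, measurable A -> measurable B ->
  Pr ((U @^-1` A) `&` (V @^-1` B)) = (\int[Pr]_(w in U @^-1` A) q (U w) B)%E.
Local Open Scope ereal_scope.

(** Both sides integrate [phi] against finite measures on [S * E]. By [UV_law] these agree on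
    measurable rectangles, a generating pi-system, hence everywhere. *)
Lemma integral_conditional_law (phi : S * E -> \bar R) :
  measurable_fun setT phi -> (forall x, 0 <= phi x) ->
  \int[Pr]_w phi (U w, V w) = \int[Pr]_w \int[q (U w)]_z phi (U w, z).
Proof.
move=> mphi phi0.
have mU := measurable_funPT U; have mV := measurable_funPT V.
have mUV : measurable_fun setT (fun w => (U w, V w)) by exact: measurable_fun_pair.
pose UV : {mfun Omega >-> (S * E)%type} := HB.pack (fun w => (U w, V w))
  (isMeasurableFun.Build _ _ _ _ _ mUV).
have mUsnd : measurable_fun setT (fun x : unit * Omega => U x.2).
  exact: measurableT_comp.
pose Usnd : {mfun (unit * Omega)%type >-> S} := HB.pack (fun x : unit * Omega => U x.2)
  (isMeasurableFun.Build _ _ _ _ _ mUsnd).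
have mpair : measurable_fun setT (fun x : (unit * Omega) * E => (U x.1.2, x.2)).
  apply: measurable_fun_pair => //.
  by apply: measurableT_comp => //; exact: measurableT_comp.
(* The constant kernel on [unit] turns the composition of kernels into the
   measure Pr(dw) q(U w, dz) pushed to S * E. *)
pose l0 := kprobability (measurable_cst (Pr : pprobability Omega R) : measurable_fun [set: unit] _).
pose k0 := kernel_comp q Usnd.
pose k1 := kdirac (R := R) mpair.
have nuE (psi : S * E -> \bar R) : measurable_fun setT psi -> (forall x, 0 <= psi x) ->
    \int[kcomp l0 (mkcomp k0 k1) tt]_x psi x =
    \int[Pr]_w \int[q (U w)]_z psi (U w, z).
  move=> mpsi psi0; rewrite integral_kcomp//; apply: eq_integral => w _.
  rewrite integral_kcomp//; apply: eq_integral => z _.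
  by rewrite integral_dirac// diracT mul1e.
rewrite -nuE// -(ge0_integral_distribution UV)//.
apply: eq_measure_integral => A mA _.
apply: (measure_unique [set B `*` C | B in measurable & C in measurable]
  (fun=> setT)) => //.
- exact: measurable_prod_measurableType.
- move=> _ _ [B1 mB1 [C1 mC1 <-]] [B2 mB2 [C2 mC2 <-]].
  exists (B1 `&` B2); first exact: measurableI.
  by exists (C1 `&` C2); [exact: measurableI|rewrite setXI].
- by move=> i; exists setT => //; exists setT => //; rewrite setXTT.
- by rewrite bigcup_const.
- move=> _ [B mB [C mC <-]].
  rewrite [LHS](_ : _ = Pr ((U @^-1` B) `&` (V @^-1` C)))// UV_law// integral_mkcond.
  apply: eq_integral => w _ /=; rewrite patchE /kcomp /=.
  under [RHS]eq_integral => z _.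
    rewrite /k1 /kdirac/= diracE in_setX /=; over.
  (* The inner integral is [q (U w) C] when [U w] lies in [B], and 0 otherwise. *)
  case: ifPn => [|] UB.
    have -> /= : (U w \in B) = true by apply/mem_set; exact: (set_mem UB).
    under eq_integral do rewrite -indicE.
    by rewrite integral_indic// setIT.
  have -> /= : (U w \in B) = false.
    by apply/negbTE/negP => /set_mem UwB; move/negP: UB; apply; exact/mem_set.
  by rewrite integral0.
- by move=> i; rewrite [X in (X < _)]probability_setT ltry.
Qed.

End conditional_law.

(** * Shortening and extending tuples *)

Section tuple_maps.
Context d (E : measurableType d).

Lemma measurable_nth n (x : E) i : measurable_fun setT (fun s : n.-tuple E => nth x s i).
Proof.
have [ni|ni] := ltnP i n; last first.
  apply: (eq_measurable_fun (cst x)) => [s _|]; last exact: measurable_cst.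
  by rewrite nth_default// size_tuple.
apply: (eq_measurable_fun (fun s : n.-tuple E => tnth s (Ordinal ni))).
  by move=> s _; rewrite (tnth_nth x).
exact: measurable_tnth.
Qed.

Lemma measurable_drop_last k : measurable_fun setT (@drop_last _ E k).
Proof.
apply/measurable_fun_tnthP => i.
apply: (eq_measurable_fun (fun s : k.-tuple E => nth point s i)).
  by move=> s _ /=; rewrite tnth_mktuple.
exact: measurable_nth.
Qed.

Lemma measurable_drop_first k : measurable_fun setT (@drop_first _ E k).
Proof.
apply/measurable_fun_tnthP => i.
apply: (eq_measurable_fun (fun s : k.-tuple E => nth point s i.+1)).
  by move=> s _ /=; rewrite tnth_mktuple.
exact: measurable_nth.
Qed.

HB.instance Definition _ k :=
  isMeasurableFun.Build _ _ _ _ (@drop_last _ E k) (@measurable_drop_last k).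

HB.instance Definition _ k :=
  isMeasurableFun.Build _ _ _ _ (@drop_first _ E k) (@measurable_drop_first k).

Definition last_state n (s : n.-tuple E) : E := nth point s n.-1.

HB.instance Definition _ n :=
  isMeasurableFun.Build _ _ _ _ (@last_state n) (@measurable_nth n point n.-1).

(* [nth sz.2 sz.1 k.-1] is the default value sz.2, which is thus put last. *)
Definition append_state k (sz : k.-1.-tuple E * E) : k.-tuple E :=
  [tuple nth sz.2 sz.1 i | i < k].

Arguments append_state k sz : clear implicits.

Lemma measurable_append_state k : measurable_fun setT (append_state k).
Proof.
apply/measurable_fun_tnthP => i.
have [ik|ik] := ltnP i k.-1.
  rewrite (_ : _ \o _ = (fun s : k.-1.-tuple E => nth point s i) \o fst); last first.
    apply/funext => -[s z] /=; rewrite tnth_mktuple/=.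
    by apply: set_nth_default; rewrite size_tuple.
  by apply: measurableT_comp => //; exact: measurable_nth.
rewrite (_ : _ \o _ = snd); first exact: measurable_snd.
by apply/funext => -[s z] /=; rewrite tnth_mktuple/= nth_default// size_tuple.
Qed.

Lemma drop_last_append k (s : k.-1.-tuple E) z : drop_last (append_state k (s, z)) = s.
Proof.
apply: eq_from_tnth => i; rewrite tnth_mktuple.
have ik : (i < k)%N by rewrite (leq_trans (ltn_ord i))// leq_pred.
rewrite (nth_map (Ordinal ik)) ?size_enum_ord// nth_enum_ord//= (tnth_nth z).
by [].
Qed.

Lemma append_drop_first k (x : k.-tuple E) z : append_state k (drop_first x, z) = Defs.shift x z.
Proof.
apply: eq_from_tnth => i; rewrite !tnth_mktuple/=.
have [ik|ik] := ltnP i k.-1.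
  rewrite (nth_map (Ordinal ik)) ?size_enum_ord// nth_enum_ord//=.
  by apply: set_nth_default; rewrite size_tuple; move: ik; clear; lia.
(* At the last index both lists are exhausted and return their default [z]. *)
rewrite !nth_default ?size_tuple ?card_ord//.
by move: ik (ltn_ord i); clear; lia.
Qed.

(** For k = 1 the shortened tuple would be empty and its last state the default [point], whence the
    bound on [k]. *)
Lemma last_drop_first k (x : k.-tuple E) : (2 <= k)%N ->
  last_state (drop_first x) = nth point x k.-1.
Proof.
case: k x => [|[|k]]// x _; rewrite /last_state /drop_first.
by rewrite (nth_map ord0) ?size_enum_ord//= nth_enum_ord.
Qed.

End tuple_maps.
Arguments append_state {d E} k sz.

(** * The window chain as an instance of the one-step setting *)

Section markov_window.
Context d dE (Omega : measurableType d) (E : measurableType dE) (R : realType).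
Variables (Pr : probability Omega R) (X : int -> {RV Pr >-> E}).
Variables (nu : probability E R) (K : R.-pker E ~> E).
Hypothesis chainX : stationary_markov_chain X nu K.
Variable k : nat.
Hypothesis k_ge2 : (2 <= k)%N.

Let pik := window_law X k.
Let last_kernel : R.-pker k.-1.-tuple E ~> E := kernel_comp K (@last_state _ E k.-1).

(** The window starting at time 1 ends at time k-1, and a tuple is measurable for the past as soon
    as its coordinates are. *)
Lemma past_window (A : set (k.-1.-tuple E)) : measurable A ->
  past X k.-1%:Z (window X 1 k.-1 @^-1` A).
Proof.
move=> mA; pose G := \bigcup_(s in [set s : int | s <= k.-1%:Z])
  preimage_set_system [set: Omega] (X s) measurable.
have mW : measurable_fun (T := g_sigma_algebraType G) setT (window X 1 k.-1).
  apply/measurable_fun_tnthP => i _ B mB.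
  rewrite setTI; apply: sub_sigma_algebra.
  exists (1 + i%:Z).
    rewrite /= -PoszD lez_nat add1n; exact: ltn_ord.
  exists B => //; rewrite setTI.
  by apply/seteqP; split => w /=; rewrite tnth_mktuple.
by have := mW measurableT A mA; rewrite setTI.
Qed.

Lemma append_window w :
  append_state k (window X 1 k.-1 w, X (k.-1%:Z + 1) w) = window X 1 k w.
Proof.
apply: eq_from_tnth => i; rewrite !tnth_mktuple/=.
have [ik|ik] := ltnP i k.-1.
  by rewrite (nth_map (Ordinal ik)) ?size_enum_ord// nth_enum_ord.
rewrite nth_default ?size_tuple ?card_ord//.
by congr (X _ w); move: (ltn_ord i) ik k_ge2; clear; lia.
Qed.

Lemma drop_last_window w : drop_last (window X 1 k w) = window X 1 k.-1 w.
Proof. by rewrite -append_window drop_last_append. Qed.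

Lemma drop_first_window w : drop_first (window X 1 k w) = window X 2 k.-1 w.
Proof.
apply: eq_from_tnth => i; rewrite !tnth_mktuple/=.
have ik : (i.+1 < k)%N by move: (ltn_ord i); clear; lia.
rewrite (nth_map (Ordinal ik)) ?size_enum_ord// nth_enum_ord//.
Qed.

(** Under pi_k the two maps have the laws of the windows of length k-1 starting at times 1 and 2,
    which stationarity identifies. *)
Lemma drop_last_drop_first_law (A : set (k.-1.-tuple E)) : measurable A ->
  distribution pik (@drop_last _ E k) A = distribution pik (@drop_first _ E k) A.
Proof.
move=> mA.
have -> : distribution pik (@drop_last _ E k) A = distribution Pr (window X 1 k.-1) A.
  congr (Pr _); apply/seteqP; split => w /=; rewrite drop_last_window//.
have -> : distribution pik (@drop_first _ E k) A = distribution Pr (window X 2 k.-1) A.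
  congr (Pr _); apply/seteqP; split => w /=; rewrite drop_first_window//.
exact: chain_stationary chainX _ _ _ _ mA.
Qed.

(** The Markov property at time k-1, for past events about (X_1, ..., X_{k-1}), makes [last_kernel]
    the conditional law of X_k given that window. *)
Lemma window_disintegration (phi : k.-tuple E -> \bar R) :
  measurable_fun setT phi -> (forall x, 0 <= phi x)%E ->
  (\int[pik]_x phi x = \int[pik]_x \int[last_kernel (drop_last x)]_z
     phi (append_state k (drop_last x, z)))%E.
Proof.
move=> mphi phi0.
have mpsi : measurable_fun setT (phi \o @append_state _ E k).
  by apply: measurableT_comp => //; exact: measurable_append_state.
have mint : measurable_fun setT (fun s : k.-1.-tuple E =>
    \int[last_kernel s]_z phi (append_state k (s, z)))%E.
  apply: (measurable_fun_integral_finite_kernel (phi \o @append_state _ E k)) => //.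
  by move=> x; exact: phi0.
rewrite (ge0_integral_distribution (window X 1 k))//.
rewrite (ge0_integral_distribution (window X 1 k) (f := fun x =>
  \int[last_kernel (drop_last x)]_z phi (append_state k (drop_last x, z)))%E); last 2 first.
- exact: (measurableT_comp mint (measurable_funPT (@drop_last _ E k))).
- by move=> x; exact: integral_ge0.
under eq_integral => w _ do rewrite /= -append_window.
under [RHS]eq_integral => w _ do rewrite /= drop_last_window.
apply: (@integral_conditional_law _ _ _ _ _ _ _ _ (window X 1 k.-1) (X (k.-1%:Z + 1))
  last_kernel _ (phi \o @append_state _ E k)) => //; last first.
  by move=> x; exact: phi0.
move=> A B mA mB; rewrite (chain_markov chainX (past_window mA) mB).
apply: eq_integral => w _; congr (K _ B).
(* The last coordinate has index k-2 and is X at time 1 + (k-2) = k-1, the time of the Markov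
   property. *)
have ik : (k.-2 < k.-1)%N by move: k_ge2; clear; lia.
rewrite [RHS](_ : _ = tnth (window X 1 k.-1 w) (Ordinal ik)); last first.
  by rewrite (tnth_nth point).
rewrite tnth_mktuple/=.
by congr (X _ w); move: k_ge2; clear; lia.
Qed.

(** [shift] drops the first state and appends [z], and the state that governs [K] survives the drop
    because [k] is at least 2. *)
Lemma transition_one_step :
  @transition dE E R k K = one_step (@drop_first _ E k) last_kernel (@append_state _ E k).
Proof.
apply/funext => f; apply/funext => x; rewrite /transition /one_step /condexp.
rewrite -last_drop_first//.
by apply: eq_Rintegral => z _; rewrite append_drop_first.
Qed.

End markov_window.

Theorem theorem3p3 (d dE : measure_display) (Omega : measurableType d)
    (E : measurableType dE) (R : realType) (Pr : probability Omega R)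
    (X : int -> {RV Pr >-> E}) (nu : probability E R) (K : R.-pker E ~> E)
    (chainX : stationary_markov_chain X nu K) (k : nat) (k_ge2 : (2 <= k)%N) :
  let pik := window_law X k in
  let Pk := @transition dE E R k K in
  let Pkstar := adjoint pik Pk in
  let Ik := incremental_space pik in
  let Dk := green_kubo_domain pik Pk in
  let Bk := green_kubo pik Pk in
  [/\ Ik = kernel_space pik Pk `&` kernel_space pik Pkstar,
      (forall f, Ik f -> forall h, (1 <= h)%N ->
        iter h Pk f = cst 0 %[ae pik] /\ iter h Pkstar f = cst 0 %[ae pik]),
      (forall f, Ik f -> Dk f /\ Bk f = f %[ae pik]),
      (Ik <> zero_space pik -> has_eigenvalue pik Dk Bk 1) &
      (forall f, Ik f -> ~ (f = cst 0 %[ae pik]) ->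
        eigenfunction pik Dk Bk 1 f)].
Proof.
move=> pik Pk Pkstar Ik Dk Bk.
(* Dictionary with the one-step setting: [front] is [drop_last], [rear] is [drop_first], [step] is
   [append_state], and the kernel reads the last coordinate of the shortened window. *)
pose q := kernel_comp K (@last_state _ E k.-1).
pose drop_last_k : {mfun k.-tuple E >-> k.-1.-tuple E} := @drop_last _ E k.
pose drop_first_k : {mfun k.-tuple E >-> k.-1.-tuple E} := @drop_first _ E k.
have PkE : Pk = one_step drop_first_k q (append_state k) by exact: transition_one_step.
have mstep := @measurable_append_state _ E k.
have stepK s z : drop_last_k (append_state k (s, z)) = s by exact: drop_last_append.
have same_law := drop_last_drop_first_law chainX k_ge2.
have disint := window_disintegration chainX k_ge2.
have PL f : L2_0 pik f -> L2_0 pik (Pk f).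
  by rewrite PkE; apply: (one_step_L2_0 mstep stepK same_law disint).
have Pae0 f : zero_space pik f -> Pk f = cst 0 %[ae pik].
  by rewrite PkE; apply: (one_step_ae0 mstep stepK same_law disint).
have PsL f : L2_0 pik f -> L2_0 pik (Pkstar f).
  by rewrite /Pkstar PkE => /(adjoint_one_stepP mstep stepK same_law disint)[].
have Psae0 f : zero_space pik f -> Pkstar f = cst 0 %[ae pik].
  by rewrite /Pkstar PkE; apply: (adjoint_one_step_ae0 mstep stepK same_law disint).
have IkE : Ik = kernel_space pik Pk `&` kernel_space pik Pkstar.
  by rewrite /Pkstar PkE; exact: (incremental_kernel mstep stepK same_law disint).
have BkE f : Ik f -> Dk f /\ Bk f = f %[ae pik].
  by rewrite IkE => -[kf kf']; exact: (green_kubo_kernel PL Pae0 PsL Psae0).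
have eigen f : Ik f -> ~ (f = cst 0 %[ae pik]) -> eigenfunction pik Dk Bk 1 f.
  move=> /BkE[Df Bf] f0; split => //.
  by apply: filterS Bf => x /= /[apply] ->; rewrite mul1r.
split => //.
- move=> f; rewrite IkE => -[kf kf'] h h1.
  by split; [case: (iter_kernel_space PL Pae0 kf h1)|
             case: (iter_kernel_space PsL Psae0 kf' h1)].
- move=> Ik0; suff [f [If f0]] : exists f, Ik f /\ ~ (f = cst 0 %[ae pik]).
    by exists f; exact: eigen.
  (* If all elements of [Ik] were a.e. zero, [Ik] would equal [zero_space], since a.e. zero
     functions lie in both kernels. *)
  apply: contrapT => nex; apply: Ik0; apply/seteqP; split => f.
    move=> If; split; first by case: If.
    by apply: contrapT => f0; apply: nex; exists f.
  by move=> zf; rewrite IkE; split; split; [case: zf|exact: Pae0|case: zf|exact: Psae0].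
Qed.
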